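(* Let $\alpha>k\ge 2$ be integers, let $H=(V,E)$ be a graph with $\alpha(H)=k$, and let $G=H\oplus\overline{K_{\alpha-k}}$ be the graph obtained from $H$ by adding $\alpha-k$ isolated nodes. Assume that the graph $H_c=(V,E_c)$ is connected, where $E_c\subseteq E$ is the set of critical edges of $H$, and that $\vartheta\text{-rank}(G)=1$. Then $$\alpha\le \frac{k(k+3)}{k-1}=k+4+\frac{4}{k-1}.$$
   Context: All graphs are finite and simple with nonempty vertex set. For a graph $G=(V=[n],E)$, $\alpha(G)$ is the maximum cardinality of a stable (independent) set, $A_G$ is the adjacency matrix, $I$ the identity and $J$ the all-ones matrix. An edge $e$ is critical if $\alpha(G\setminus e)=\alpha(G)+1$, where $G\setminus e$ is obtained by deleting the edge $e$. For $r\in\mathbb N=\{0,1,\dots\}$, $\mathcal K_n^{(r)}$ is the set of real symmetric $n\times n$ matrices $M$ such that $(\sum_{i=1}^n x_i^2)^r\sum_{i,j=1}^n M_{ij}x_i^2x_j^2$ is a sum of squares of real polynomials. The $\vartheta$-rank of $G$, $\vartheta\text{-rank}(G)$, is the smallest $r\in\mathbb N$ with $\alpha(G)(A_G+I)-J\in\mathcal K_n^{(r)}$, and $\infty$ if no such $r$ exists. $\oplus$ denotes disjoint union of graphs and $\overline{K_m}$ is the graph consisting of $m$ isolated nodes. *)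

(* Defs.v *)
From HB Require Import structures.
(* [mpoly] comes first: it shadows the [symmetric] of [ssrbool]. *)
From mathcomp Require Import mpoly.
From mathcomp Require Import all_boot all_order all_algebra.
From mathcomp Require Import boolp reals.

Set Implicit Arguments.
Unset Strict Implicit.
Unset Printing Implicit Defensive.

Import Order.TTheory GRing.Theory Num.Theory.

Local Open Scope ring_scope.

Record graph (n : nat) := Graph {
  adj :> rel 'I_n;
  adj_sym : symmetric adj;
  adj_irr : irreflexive adj
}.

Section Graphs.
Variable n : nat.
Implicit Types (G : graph n) (S : {set 'I_n}) (u v x y : 'I_n).

Definition stable G S : bool := [forall x in S, forall y in S, ~~ G x y].

Definition alpha G : nat := (\max_(S : {set 'I_n} | stable G S) #|S|)%N.

Definition del_adj G u v : rel 'I_n :=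
  [rel x y | G x y && ([set x; y] != [set u; v])].

Lemma del_adj_sym G u v : symmetric (del_adj G u v).
Proof. by move=> x y; rewrite /del_adj /= (adj_sym G x) (setUC [set x]). Qed.

Lemma del_adj_irr G u v : irreflexive (del_adj G u v).
Proof. by move=> x; rewrite /del_adj /= (adj_irr G). Qed.

Definition del_edge G u v : graph n :=
  Graph (del_adj_sym G u v) (del_adj_irr G u v).

Definition critical G : rel 'I_n :=
  [rel u v | G u v && (alpha (del_edge G u v) == (alpha G).+1)].

Lemma critical_sym G : symmetric (critical G).
Proof.
move=> u v; rewrite /critical /= (adj_sym G u); congr (_ && (_ == _)).
apply: eq_bigl => S; apply: eq_forallb => x; congr (_ ==> _).
by apply: eq_forallb => y; rewrite /= /del_adj /= (setUC [set u]).
Qed.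

Lemma critical_irr G : irreflexive (critical G).
Proof. by move=> x; rewrite /critical /= (adj_irr G). Qed.

Definition critical_graph G : graph n :=
  Graph (@critical_sym G) (@critical_irr G).

Definition connected G : Prop := forall u v, connect G u v.

End Graphs.

Section DisjointUnion.
Variables (n m : nat) (G : graph n) (H : graph m).

Definition dunion_adj : rel 'I_(n + m) := fun x y =>
  match split x, split y with
  | inl u, inl v => G u v
  | inr u, inr v => H u v
  | _, _ => false
  end.

Lemma dunion_sym : symmetric dunion_adj.
Proof.
move=> x y; rewrite /dunion_adj.
by case: (split x) => u; case: (split y) => v //; [rewrite (adj_sym G) | rewrite (adj_sym H)].
Qed.

Lemma dunion_irr : irreflexive dunion_adj.
Proof.
by move=> x; rewrite /dunion_adj; case: (split x) => u; [rewrite (adj_irr G) | rewrite (adj_irr H)].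
Qed.

Definition dunion : graph (n + m) := Graph dunion_sym dunion_irr.

End DisjointUnion.

Section Edgeless.
Variable m : nat.

Lemma edgeless_sym : symmetric (fun _ _ : 'I_m => false).
Proof. by []. Qed.

Lemma edgeless_irr : irreflexive (fun _ _ : 'I_m => false).
Proof. by []. Qed.

Definition edgeless : graph m := Graph edgeless_sym edgeless_irr.

End Edgeless.

Section ThetaRank.
Variables (R : realType) (n : nat).

Definition sum_of_squares (p : {mpoly R[n]}) : Prop :=
  exists s : seq {mpoly R[n]}, p = \sum_(q <- s) q ^+ 2.

Definition Kcone (r : nat) (M : 'M[R]_n) : Prop :=
  M^T = M /\
  sum_of_squares ((\sum_(i < n) 'X_i ^+ 2) ^+ r *
    \sum_(i < n) \sum_(j < n) (M i j)%:MP * 'X_i ^+ 2 * 'X_j ^+ 2).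

Definition adjmx (G : graph n) : 'M[R]_n := \matrix_(i, j) (G i j)%:R.

Definition graphmx (G : graph n) : 'M[R]_n :=
  (alpha G)%:R *: (adjmx G + 1%:M) - const_mx 1.

(* [None] stands for infinity *)
Definition theta_rank (G : graph n) : option nat :=
  match pselect (exists r, `[< Kcone r (graphmx G) >]) with
  | left exr => Some (ex_minn exr)
  | right _ => None
  end.

End ThetaRank.
Arguments theta_rank R {n} G.

(* Main.v *)
(* Let M be the matrix of G, let m be the number of isolated nodes and w their
   indicator vector. If F(x) = (sum_i x_i^2) (sum_ij M_ij x_i^2 x_j^2) is a sum
   of squares, then it is a sum of squares of cubic forms T. Each T vanishes at
   w + z for every signed indicator z of a maximum stable set S of H, and
   averaging over the signs gives T(w) = - sum_(v in S) T2(v), where T2(v) is the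
   coefficient of t^2 in T(w + t e_v). Comparing the two maximum stable sets
   given by a critical edge, T2 is constant along critical edges, hence equal to
   a constant T2 with T(w) = - k T2. Reading off the coefficients of
   F(w + t e_u) = sum_T (T(w) + t T1 + t^2 T2 + t^3 T3)^2 then determines
   sum T1^2, sum T1 T3 and sum T3^2, and the Cauchy-Schwarz inequality for T1
   and T3 is the bound on k + m. *)
Require Import Defs.
From mathcomp Require Import mpoly.
From mathcomp Require Import all_boot all_order all_algebra.
From mathcomp Require Import boolp reals ring lra.

Set Implicit Arguments.
Unset Strict Implicit.
Unset Printing Implicit Defensive.

Import Order.TTheory GRing.Theory Num.Theory.

Local Open Scope ring_scope.

(** * Functions that are cubic along every line *)

Section CubicFunctions.
Variables (R : realFieldType) (V : lmodType R).
Implicit Types (T : V -> R) (x y z : V).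

(* The polarizations [B] and [C] are left existential so that closure under
   linear combinations is immediate; they are necessarily [polar1 T] and
   [polar2 T]. *)
Definition cubic T : Prop := exists B C : V -> V -> R,
  (forall x y t, T (x + t *: y) = T x + t * B x y + t ^+ 2 * C x y + t ^+ 3 * T y)
  /\ (forall x x' y, C (x + x') y = C x y + C x' y).

(** For cubic [T] these are the coefficients of t and t^2 in T(x + t y), recovered from the values
    at t = 1 and t = -1. *)
Definition polar1 T x y : R := (T (x + y) - T (x - y)) / 2 - T y.
Definition polar2 T x y : R := (T (x + y) + T (x - y)) / 2 - T x.

Lemma cubic_polarE T (BC : V -> V -> R) B C x y :
  (forall x y t, T (x + t *: y) = T x + t * B x y + t ^+ 2 * C x y + t ^+ 3 * T y) ->
  polar1 T x y = B x y /\ polar2 T x y = C x y.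
Proof.
move=> TE; have := TE x y 1; have := TE x y (-1).
rewrite scaleN1r scale1r /polar1 /polar2 => -> ->.
by split; field.
Qed.

Lemma cubic_expand T x y t : cubic T ->
  T (x + t *: y) = T x + t * polar1 T x y + t ^+ 2 * polar2 T x y + t ^+ 3 * T y.
Proof. by case=> B [C [TE _]]; have [-> ->] := cubic_polarE B x y TE. Qed.

Lemma polar2D T x x' y : cubic T ->
  polar2 T (x + x') y = polar2 T x y + polar2 T x' y.
Proof.
case=> B [C [TE CD]].
have pE u v : polar2 T u v = C u v by have [] := cubic_polarE B u v TE.
by rewrite !pE CD.
Qed.

Lemma polar2N T x y : cubic T -> polar2 T (- x) y = - polar2 T x y.
Proof.
move=> cT; have := polar2D x (- x) y cT; have := polar2D 0 0 y cT.
by rewrite subrr addr0; lra.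
Qed.

Lemma cubic_ext T T' : T =1 T' -> cubic T -> cubic T'.
Proof. by move=> eT [B [C [TE CD]]]; exists B, C; split=> // x y t; rewrite -!eT. Qed.

Lemma cubic0 : cubic (fun=> 0).
Proof. by exists (fun _ _ => 0), (fun _ _ => 0); split=> *; ring. Qed.

Lemma cubicD T T' : cubic T -> cubic T' -> cubic (fun x => T x + T' x).
Proof.
case=> B [C [TE CD]] [B' [C' [TE' CD']]].
exists (fun x y => B x y + B' x y), (fun x y => C x y + C' x y).
by split=> *; rewrite ?TE ?TE' ?CD ?CD'; ring.
Qed.

Lemma cubicZ c T : cubic T -> cubic (fun x => c * T x).
Proof.
case=> B [C [TE CD]]; exists (fun x y => c * B x y), (fun x y => c * C x y).
by split=> *; rewrite ?TE ?CD; ring.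
Qed.

Lemma cubic_sum (I : Type) (s : seq I) (T : I -> V -> R) :
  (forall i, cubic (T i)) -> cubic (fun x => \sum_(i <- s) T i x).
Proof.
move=> cT; elim: s => [|i s IH].
  by apply: cubic_ext cubic0 => x; rewrite big_nil.
by apply: cubic_ext (cubicD (cT i) IH) => x; rewrite big_cons.
Qed.

End CubicFunctions.

(** * Cubic functions of row vectors and cubic parts of polynomials *)

Section CubicRow.
Variables (R : realFieldType) (N : nat).
Implicit Types (x y z : 'rV[R]_N) (T : 'rV[R]_N -> R).

Lemma cubic_monomial (i j l : 'I_N) :
  cubic (fun x : 'rV[R]_N => x 0 i * x 0 j * x 0 l).
Proof.
exists (fun x y => x 0 i * x 0 j * y 0 l + x 0 i * y 0 j * x 0 l + y 0 i * x 0 j * x 0 l).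
exists (fun x y => x 0 i * y 0 j * y 0 l + y 0 i * x 0 j * y 0 l + y 0 i * y 0 j * x 0 l).
by split=> *; rewrite !mxE; ring.
Qed.

(* Averaging over the sign of each coordinate in [s] kills the terms of odd
   degree in it, so only [T x] and the terms quadratic in one coordinate
   survive. *)
Lemma cubic_sign_average T (s : seq 'I_N) x : cubic T -> uniq s ->
  (forall z, (forall i, z 0 i ^+ 2 = (i \in s)%:R) -> T (x + z) = 0) ->
  T x + \sum_(v <- s) polar2 T x (delta_mx 0 v) = 0.
Proof.
move=> cT; elim: s x => [|v s IH] x /=.
  move=> _ T0; rewrite big_nil addr0 -[x]addr0; apply: T0 => i.
  by rewrite mxE expr0n.
case/andP=> vs us T0; rewrite big_cons.
have T1 c : c ^+ 2 = 1 -> T (x + c *: delta_mx 0 v) +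
    \sum_(w <- s) polar2 T (x + c *: delta_mx 0 v) (delta_mx 0 w) = 0.
  move=> c1; apply: IH us _ => z zs; rewrite -addrA; apply: T0 => i.
  rewrite !mxE eqxx inE /=; have [->|_] := eqVneq i v; last first.
    by rewrite mulr0 add0r zs.
  have /eqP := zs v; rewrite (negbTE vs) sqrf_eq0 => /eqP ->.
  by rewrite mulr1 addr0 c1.
have sumE c : \sum_(w <- s) polar2 T (x + c *: delta_mx 0 v) (delta_mx 0 w) =
    \sum_(w <- s) polar2 T x (delta_mx 0 w) +
    \sum_(w <- s) polar2 T (c *: delta_mx 0 v) (delta_mx 0 w).
  by rewrite -big_split /=; apply: eq_bigr => w _; rewrite polar2D.
have := T1 1 (expr1n _ _); have := T1 (-1) (etrans (sqrrN 1) (expr1n _ _)).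
(* [polar2] is odd in its first argument, so these sums cancel when the cases c = 1 and c = -1 are
   added; half the sum of the two values of [T] supplies the new term at [v]. *)
have sumN : \sum_(w <- s) polar2 T (-1 *: delta_mx 0 v) (delta_mx 0 w) =
    - \sum_(w <- s) polar2 T (1 *: delta_mx 0 v) (delta_mx 0 w).
  by rewrite -sumrN; apply: eq_bigr => w _; rewrite scaleN1r scale1r polar2N.
rewrite !sumE sumN scale1r scaleN1r [polar2 T x (delta_mx 0 v)]/polar2; lra.
Qed.

Variable q : {mpoly R[N]}.

(** The coefficient of t^3 in q(t x), that is, the homogeneous component of degree 3 of [q]
    evaluated at [x]. *)
Definition cubic_part (x : 'rV[R]_N) : R :=
  (mmap polyC (fun i => x 0 i *: 'X) q)`_3.

Lemma mmap1_scaleX (h : 'I_N -> R) (m : 'X_{1..N}) :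
  mmap1 (fun i => h i *: 'X : {poly R}) m = mmap1 h m *: 'X^(mdeg m).
Proof.
rewrite /mmap1 mdegE -prodrXr.
rewrite -scaler_prod; apply: eq_bigr => i _.
by rewrite exprZn.
Qed.

(** Splitting off one variable at a time ([step]) brings a monomial of degree 3 into the shape
    handled by [cubic_monomial]. *)
Lemma mmap1_mdeg3 (m : 'X_{1..N}) : mdeg m = 3 ->
  exists i j l, forall h : 'I_N -> R, mmap1 h m = h i * h j * h l.
Proof.
have step d (m' : 'X_{1..N}) : mdeg m' = d.+1 -> exists i m'',
    mdeg m'' = d /\ forall h : 'I_N -> R, mmap1 h m' = h i * mmap1 h m''.
  move=> dm; have [i mi] : exists i, m' i != 0%N.
    apply/existsP; apply: contra_eqT dm => /existsPn m0.
    by rewrite mdegE big1 // => i _; apply/eqP; rewrite -[_ == _]negbK m0.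
  have lm : (U_(i) <= m')%MM.
    apply/mnm_lepP => j; rewrite mnm1E; case: eqP => // <-.
    by rewrite lt0n.
  exists i, (m' - U_(i))%MM; split=> [|h].
    by apply/eqP; rewrite -eqSS -dm -[in X in _ == X](submK lm) mdegD mdeg1 addn1.
  have {1}-> : m' = (U_(i) + (m' - U_(i)))%MM by rewrite addmC submK.
  rewrite commr_mmap1_M ?mmap1U // => *; exact: mulrC.
move=> /step [i [m1 [/step [j [m2 [/step [l [m3 [/eqP]]]]]]]]].
rewrite mdeg_eq0 => /eqP -> h3 h2 h1; exists i, j, l => h.
by rewrite h1 h2 h3 mmap11 mulr1 mulrA.
Qed.

Lemma cubic_part_cubic : cubic cubic_part.
Proof.
rewrite /cubic_part /mmap.
apply: (@cubic_ext _ _ (fun x => \sum_(m <- msupp q)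
   q@_m * (mmap1 (x 0) m * (3 == mdeg m)%:R))) => [x|].
  rewrite coef_sum; apply: eq_bigr => m _.
  by rewrite coefCM mmap1_scaleX coefZ coefXn.
apply: cubic_sum => m; apply: cubicZ.
have [dm|_] := eqVneq; last by apply: cubic_ext (cubic0 _) => x; rewrite mulr0.
have [i [j [l mE]]] := mmap1_mdeg3 (esym dm).
by apply: cubic_ext (cubic_monomial i j l) => x; rewrite mE mulr1.
Qed.

End CubicRow.

(** * Vanishing and leading coefficients of sums of squares *)

Lemma sum_sq_eq0 (R : realFieldType) (I : eqType) (s : seq I) (f : I -> R) :
  \sum_(i <- s) f i ^+ 2 = 0 -> forall i, i \in s -> f i = 0.
Proof.
move/eqP; rewrite psumr_eq0 => [|i _]; last exact: sqr_ge0.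
by move/allP => fs i /fs; rewrite sqrf_eq0 => /eqP.
Qed.

(* A lowest-degree part of degree below 3 would contribute a nonzero sum of
   squares of degree below 6. *)
Lemma sum_sq_coef3 (R : realFieldType) (I : eqType) (s : seq I)
    (f : I -> {poly R}) c :
  \sum_(i <- s) f i ^+ 2 = c *: 'X^6 -> \sum_(i <- s) (f i)`_3 ^+ 2 = c.
Proof.
have coef0_sum (g : I -> {poly R}) :
    (\sum_(i <- s) g i ^+ 2)`_0 = \sum_(i <- s) (g i)`_0 ^+ 2.
  by rewrite coef_sum; apply: eq_bigr => i _; rewrite expr2 coef0M.
(* The constant coefficients vanish, so ['X] divides every [g i]. Three such divisions turn ['X^6]
   into a constant and coefficient 3 into coefficient 0. *)
have step (g : I -> {poly R}) d : \sum_(i <- s) g i ^+ 2 = c *: 'X^(d.+2) ->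
   \sum_(i <- s) drop_poly 1 (g i) ^+ 2 = c *: 'X^d.
  move=> gE; apply: (@mulIf _ ('X^2 : {poly R})); first by rewrite -size_poly_eq0 size_polyXn.
  rewrite -scalerAl -exprD addn2 -gE mulr_suml; apply: eq_big_seq => i si.
  rewrite -exprMn; congr (_ ^+ 2).
  have gi0 : (g i)`_0 = 0.
    apply: (@sum_sq_eq0 _ _ s (fun i => (g i)`_0)) si.
    by rewrite -coef0_sum gE coefZ coefXn mulr0.
  apply/polyP => [[|j]]; rewrite coefMX //= coef_drop_poly.
  by rewrite addn1.
move=> /step /step /step fE.
have := congr1 (fun p : {poly R} => p`_0) fE.
rewrite /= coef0_sum coefZ coefXn mulr1 => <-.
by apply: eq_bigr => i _; rewrite !coef_drop_poly.
Qed.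

(** * From a certificate for [Kcone 1] to cubic functions *)

Section Kcone1.
Variables (R : realType) (N : nat) (M : 'M[R]_N).

(** The form of degree 6 that [Kcone 1 M] requires to be a sum of squares, as a function of [x]. *)
Definition biquadratic (x : 'rV[R]_N) : R :=
  (\sum_i x 0 i ^+ 2) * \sum_i \sum_j M i j * x 0 i ^+ 2 * x 0 j ^+ 2.

(** Substituting t x for the variables turns the certificate into an identity of polynomials in t
    whose value is [biquadratic x] times t^6; [sum_sq_coef3] then keeps only the cubic parts. *)
Lemma Kcone1_cubic : Kcone 1 M -> exists (I : eqType) (s : seq I) (T : I -> 'rV[R]_N -> R),
  (forall i, cubic (T i)) /\ forall x, \sum_(i <- s) T i x ^+ 2 = biquadratic x.
Proof.
case=> _ [s sE]; exists {mpoly R[N]}, s, (@cubic_part R N); split=> [q|x].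
  exact: cubic_part_cubic.
apply: sum_sq_coef3.
under eq_bigr do rewrite -rmorphXn.
rewrite -rmorph_sum /= -sE rmorphM /= expr1 !rmorph_sum /=.
have mmapU i : mmap polyC (fun i => x 0 i *: 'X) ('X_i : {mpoly R[N]}) = x 0 i *: 'X.
  by rewrite mmapX mmap1U.
have -> : \sum_(i < N) mmap polyC (fun i => x 0 i *: 'X) ('X_i ^+ 2) =
    (\sum_i x 0 i ^+ 2) *: 'X^2 :> {poly R}.
  rewrite scaler_suml; apply: eq_bigr => i _.
  by rewrite rmorphXn /= mmapU exprZn.
have -> : \sum_(i < N) mmap polyC (fun i => x 0 i *: 'X)
      (\sum_(j < N) (M i j)%:MP * 'X_i ^+ 2 * 'X_j ^+ 2) =
    (\sum_i \sum_j M i j * x 0 i ^+ 2 * x 0 j ^+ 2) *: 'X^4 :> {poly R}.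
  rewrite scaler_suml; apply: eq_bigr => i _.
  rewrite rmorph_sum scaler_suml; apply: eq_bigr => j _ /=.
  rewrite 2!rmorphM !rmorphXn /= mmapC !mmapU !exprZn mul_polyC.
  by rewrite scalerA -scalerAl -scalerAr scalerA -exprD.
by rewrite -scalerAl -scalerAr scalerA -exprD.
Qed.

End Kcone1.

(** * Stable sets and the stability number *)

Section StableSets.
Variables (n : nat) (G : graph n).
Implicit Types (S : {set 'I_n}).

Lemma stableP S : reflect {in S &, forall x y, ~~ G x y} (stable G S).
Proof.
apply: (iffP forall_inP) => [h x y xS yS|h x xS].
  by have /forall_inP/(_ y yS) := h x xS.
by apply/forall_inP => y yS; apply: h.
Qed.

Lemma stable_sub S S' : S' \subset S -> stable G S -> stable G S'.
Proof.
move=> /subsetP sub /stableP st; apply/stableP => x y /sub xS /sub yS.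
exact: st.
Qed.

Lemma stable_leq_alpha S : stable G S -> (#|S| <= alpha G)%N.
Proof. exact: (@leq_bigmax_cond _ (stable G) (fun S => #|S|) S). Qed.

Lemma alpha_attained : exists2 S, stable G S & #|S| = alpha G.
Proof.
have st0 : stable G set0 by apply/stableP => x y; rewrite inE.
have [|S st SE] := @eq_bigmax_cond _ (stable G) (fun S => #|S|).
  by apply/card_gt0P; exists set0.
by exists S => //; rewrite -SE.
Qed.

End StableSets.

(** * Maximum stable sets at a critical edge *)

Section CriticalEdges.
Variables (n : nat) (G : graph n).
Implicit Types (S : {set 'I_n}).

Lemma del_edge_stable u v S : stable (del_edge G u v) S ->
  (u \notin S) || (v \notin S) -> stable G S.
Proof.
move=> /stableP st uvS; apply/stableP => x y xS yS; apply/negP => xy.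
have := st x y xS yS; rewrite /= /del_adj /= xy /= negbK => /eqP/setP xyE.
have sub w : w \in [set u; v] -> w \in S.
  by rewrite -xyE => /set2P [] ->.
by move: uvS; rewrite !sub ?set21 ?set22.
Qed.

(** A maximum stable set [T] after deletion of the edge is too large to be stable in [G], so it
    contains both ends; [S] is [T] without [u] and [v]. *)
Lemma critical_edge_split u v : critical G u v -> exists S,
  [/\ u \notin S, v \notin S, stable G (u |: S) /\ #|u |: S| = alpha G
    & stable G (v |: S) /\ #|v |: S| = alpha G].
Proof.
case/andP=> uv /eqP aE.
have [T st cT] := alpha_attained (del_edge G u v).
have /norP[]: ~~ ((u \notin T) || (v \notin T)).
  apply/negP => /(del_edge_stable st)/stable_leq_alpha.
  by rewrite cT aE ltnn.
rewrite !negbK => uT vT.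
have uv' : u != v by apply: contraTneq uv => ->; rewrite (adj_irr G).
have uE : u |: T :\ u :\ v = T :\ v.
  by apply/setP => x; rewrite !inE; have [->|] := eqVneq x u; rewrite ?uT ?uv' ?andbT.
have vE : v |: T :\ u :\ v = T :\ u.
  by rewrite setD1K // !inE eq_sym uv'.
have cD w : w \in T -> #|T :\ w| = alpha G.
  by move=> wT; apply/eqP; rewrite -eqSS -aE -cT (cardsD1 w T) wT.
exists (T :\ u :\ v); rewrite uE vE !inE !eqxx andbF; split=> //; split; rewrite ?cD //.
  apply: (@del_edge_stable u v); last by rewrite !inE eqxx orbT.
  by apply: stable_sub st; apply: subD1set.
apply: (@del_edge_stable u v); last by rewrite !inE eqxx.
by apply: stable_sub st; apply: subD1set.
Qed.

End CriticalEdges.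

(** * Adding isolated nodes *)

Section IsolatedNodes.
Variables (n m : nat) (H : graph n).
Implicit Types S : {set 'I_n}.
Local Notation G := (dunion H (edgeless m)).

Lemma split_lshift (i : 'I_n) : split (lshift m i) = inl i.
Proof. exact: (unsplitK (inl i)). Qed.

Lemma split_rshift (i : 'I_m) : split (rshift n i) = inr i.
Proof. exact: (unsplitK (inr i)). Qed.

Lemma card_dunion (T : {set 'I_(n + m)}) :
  #|T| = (#|[set i | lshift m i \in T]| + #|[set i | rshift n i \in T]|)%N.
Proof.
rewrite -!sum1_card big_mkcond big_split_ord /=.
by congr (_ + _)%N; rewrite -big_mkcond /=; apply: eq_bigl => i; rewrite inE.
Qed.

Lemma stable_dunion (T : {set 'I_(n + m)}) :
  stable G T = stable H [set i | lshift m i \in T].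
Proof.
apply/stableP/stableP => st x y.
  rewrite !inE => xT yT; have := st _ _ xT yT.
  by rewrite /= /dunion_adj !split_lshift.
rewrite -[x]splitK -[y]splitK /= /dunion_adj !unsplitK.
case: (split x) => i; case: (split y) => j //= iT jT.
by apply: st; rewrite inE.
Qed.

Lemma alpha_dunion_edgeless : alpha G = (alpha H + m)%N.
Proof.
apply/eqP; rewrite eqn_leq; apply/andP; split.
  apply/bigmax_leqP => T; rewrite stable_dunion card_dunion => /stable_leq_alpha h.
  by apply: leq_add h _; rewrite -[leqRHS](card_ord m) max_card.
have [S st <-] := alpha_attained H.
(* A maximum stable set of [H] together with all isolated nodes. *)
pose T : {set 'I_(n + m)} := [set x | if split x is inl i then i \in S else true].
have TS : [set i | lshift m i \in T] = S.
  by apply/setP => i; rewrite !inE split_lshift.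
have TW : [set i | rshift n i \in T] = setT.
  by apply/setP => i; rewrite !inE split_rshift.
have := @stable_leq_alpha _ G T; rewrite stable_dunion card_dunion TS TW.
by rewrite cardsT card_ord; apply.
Qed.

End IsolatedNodes.

(** * Values of the form of degree 6 on vectors with stable support *)

(** On a stable support the adjacency term contributes nothing; only the identity and the all-ones
    matrix remain. *)
Lemma biquadratic_stable (R : realType) N (G : graph N) (x : 'rV[R]_N) :
  (forall i j, G i j -> x 0 i * x 0 j = 0) ->
  biquadratic (graphmx R G) x = (\sum_i x 0 i ^+ 2) *
    ((alpha G)%:R * (\sum_i x 0 i ^+ 4) - (\sum_i x 0 i ^+ 2) ^+ 2).
Proof.
move=> xG; rewrite /biquadratic; congr (_ * _).
have -> : (\sum_i x 0 i ^+ 2) ^+ 2 = \sum_i \sum_j x 0 i ^+ 2 * x 0 j ^+ 2.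
  by rewrite [LHS]expr2 big_distrlr.
have -> : \sum_i x 0 i ^+ 4 = \sum_i \sum_j (i == j)%:R * (x 0 i ^+ 2 * x 0 j ^+ 2).
  apply: eq_bigr => i _; rewrite (bigD1 i) //= eqxx big1 => [|j ji]; first by rewrite addr0 mul1r -exprD.
  by rewrite eq_sym (negbTE ji) mul0r.
rewrite mulr_sumr -sumrB; apply: eq_bigr => i _.
rewrite mulr_sumr -sumrB; apply: eq_bigr => j _; rewrite !mxE.
have [/xG x0|_] := boolP (G i j); last by rewrite mulr0n; ring.
have sq0 : x 0 i ^+ 2 * x 0 j ^+ 2 = 0 by rewrite -exprMn x0 expr0n.
by rewrite -mulrA sq0 !mulr0 subrr.
Qed.

Section Evaluation.
Variables (R : realType) (n m : nat) (H : graph n).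
Local Notation G := (dunion H (edgeless m)).
Local Notation Q := (biquadratic (graphmx R G)).

Definition isolated_vec : 'rV[R]_(n + m) := row_mx 0 (const_mx 1).
Local Notation w := isolated_vec.
Local Notation e u := (delta_mx 0 (lshift m u) : 'rV[R]_(n + m)).

Lemma dunion_edgeless_orth (x : 'rV[R]_(n + m)) :
  (forall i j, H i j -> x 0 (lshift m i) * x 0 (lshift m j) = 0) ->
  forall i j, G i j -> x 0 i * x 0 j = 0.
Proof.
move=> xH i j; rewrite -[i]splitK -[j]splitK /= /dunion_adj !unsplitK.
by case: (split i) => i'; case: (split j) => j' //= /xH.
Qed.

Lemma isolated_vecl i : w 0 (lshift m i) = 0.
Proof. by rewrite row_mxEl mxE. Qed.

Lemma isolated_vecr i : w 0 (rshift n i) = 1.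
Proof. by rewrite row_mxEr mxE. Qed.

Lemma biquadratic_line u t : Q (w + t *: e u) =
  (m%:R + t ^+ 2) * ((alpha H + m)%:R * (m%:R + t ^+ 4) - (m%:R + t ^+ 2) ^+ 2).
Proof.
have xl i : (w + t *: e u) 0 (lshift m i) = t * (i == u)%:R.
  by rewrite mxE isolated_vecl add0r !mxE eqxx eq_lshift.
have xr i : (w + t *: e u) 0 (rshift n i) = 1.
  by rewrite mxE isolated_vecr !mxE eqxx eq_rlshift mulr0 addr0.
have sumE d : \sum_i (w + t *: e u) 0 i ^+ d.+1 = m%:R + t ^+ d.+1.
  rewrite big_split_ord /= (bigD1 u) //= xl eqxx mulr1 big1 => [|i iu]; last first.
    by rewrite xl (negbTE iu) mulr0 expr0n.
  rewrite addr0 addrC; congr (_ + _).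
  under eq_bigr do rewrite xr expr1n.
  by rewrite sumr_const card_ord.
rewrite biquadratic_stable ?alpha_dunion_edgeless ?sumE //.
apply: dunion_edgeless_orth => i j ij; rewrite !xl.
have [iu|_] := eqVneq i u; last by rewrite mulr0 mul0r.
have [ju|_] := eqVneq j u; last by rewrite !mulr0.
by move: ij; rewrite iu ju (adj_irr H).
Qed.

(** The entries of [w + z] are 1 or -1 on a maximum stable set of [G] and 0 elsewhere, so the sums
    of squares and of fourth powers both equal [alpha G] and the second factor of the form
    vanishes. *)
Lemma biquadratic_max_stable (S : {set 'I_n}) (z : 'rV[R]_(n + m)) :
  stable H S -> #|S| = alpha H ->
  (forall i, z 0 i ^+ 2 = (i \in map (lshift m) (enum S))%:R) -> Q (w + z) = 0.
Proof.
move=> /stableP st cS zS.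
have zl i : z 0 (lshift m i) ^+ 2 = (i \in S)%:R.
  by rewrite zS mem_map ?mem_enum //; apply: lshift_inj.
have zr i : z 0 (rshift n i) = 0.
  apply/eqP; rewrite -sqrf_eq0 zS; case: mapP => // -[j _ /eqP].
  by rewrite eq_rlshift.
have sumE d : \sum_i (w + z) 0 i ^+ (d.+1).*2 = (alpha H + m)%:R.
  rewrite big_split_ord /= -cS -sum1_card !natrD natr_sum [X in _ = X + _]big_mkcond; congr (_ + _).
    apply: eq_bigr => i _; rewrite mxE isolated_vecl add0r -mul2n exprM zl.
    by case: (i \in S); rewrite ?expr1n ?expr0n.
  under eq_bigr do rewrite mxE isolated_vecr zr addr0 expr1n.
  by rewrite sumr_const card_ord.
rewrite biquadratic_stable ?alpha_dunion_edgeless.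
  by rewrite (sumE 0%N) (sumE 1%N) expr2 subrr mulr0.
apply: dunion_edgeless_orth => i j ij; rewrite mxE [in X in _ * X]mxE !isolated_vecl !add0r.
have z0 v : v \notin S -> z 0 (lshift m v) = 0.
  by move=> vS; apply/eqP; rewrite -sqrf_eq0 zl (negbTE vS).
have [iS|/z0->] := boolP (i \in S); last by rewrite mul0r.
have [jS|/z0->] := boolP (j \in S); last by rewrite mulr0.
by have := st i j iS jS; rewrite ij.
Qed.

Lemma cubic_max_stable (T : 'rV[R]_(n + m) -> R) (S : {set 'I_n}) :
  cubic T -> (forall x, Q x = 0 -> T x = 0) -> stable H S -> #|S| = alpha H ->
  T w + \sum_(v in S) polar2 T w (e v) = 0.
Proof.
move=> cT T0 st cS.
rewrite -big_enum -(big_map (lshift m) xpredT (fun v => polar2 T w (delta_mx 0 v))).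
apply: cubic_sign_average cT _ _ => [|z zS].
  by rewrite map_inj_uniq ?enum_uniq //; apply: lshift_inj.
exact/T0/(biquadratic_max_stable st cS).
Qed.

Lemma cubic_critical_connected (T : 'rV[R]_(n + m) -> R) u :
  cubic T -> (forall x, Q x = 0 -> T x = 0) -> connected (critical_graph H) ->
  T w = - (alpha H)%:R * polar2 T w (e u).
Proof.
move=> cT T0 conn.
(* The two maximum stable sets differ only in [v] and [v'], so subtracting their equations cancels
   [T w] and the sum over [S]. *)
have edge v v' : critical H v v' -> polar2 T w (e v) = polar2 T w (e v').
  move=> /critical_edge_split[S [vS v'S [st1 c1] [st2 c2]]].
  have := cubic_max_stable cT T0 st1 c1; have := cubic_max_stable cT T0 st2 c2.
  rewrite !big_setU1 //=; lra.
have const v : polar2 T w (e v) = polar2 T w (e u).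
  have /connectP[p] := conn v u.
  elim: p v => [v _ -> //|v' p IH v /= /andP[/edge-> pv'] uE].
  exact: IH.
have [S st cS] := alpha_attained H.
have := cubic_max_stable cT T0 st cS.
under eq_bigr do rewrite const.
rewrite sumr_const cS -[X in _ + X]mulr_natl mulNr => /eqP.
by rewrite addr_eq0 => /eqP.
Qed.

End Evaluation.

(** * Cauchy-Schwarz and comparison of coefficients *)

(** Cauchy-Schwarz: the sum of the squares of B f - C g is B (A B - C^2), and B > 0. *)
Lemma sum_mul_sqr_le (R : realFieldType) (I : Type) (s : seq I) (f g : I -> R) :
  0 < \sum_(i <- s) g i ^+ 2 ->
  (\sum_(i <- s) f i * g i) ^+ 2 <=
    (\sum_(i <- s) f i ^+ 2) * \sum_(i <- s) g i ^+ 2.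
Proof.
set A := \sum_(i <- s) f i ^+ 2; set B := \sum_(i <- s) g i ^+ 2.
set C := \sum_(i <- s) f i * g i => B0.
have : 0 <= \sum_(i <- s) (B * f i - C * g i) ^+ 2.
  by apply: sumr_ge0 => i _; apply: sqr_ge0.
rewrite (_ : \sum_(i <- s) _ = B * (A * B - C ^+ 2)).
  by rewrite pmulr_rge0 // subr_ge0.
transitivity (\sum_(i <- s) (B ^+ 2 * f i ^+ 2 + (- 2 * B * C) * (f i * g i) +
    C ^+ 2 * g i ^+ 2)); first by apply: eq_bigr => i _; ring.
by rewrite !big_split /= -!mulr_sumr -/A -/B -/C; ring.
Qed.

(* A polynomial of degree 6 in [t] is determined by its values at seven
   points. *)
Lemma sum_sq_cubic_coefs (R : realFieldType) (I : Type) (s : seq I)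
    (f0 f1 f2 f3 : I -> R) c0 c2 c4 c6 :
  (forall t, \sum_(i <- s) (f0 i + t * f1 i + t ^+ 2 * f2 i + t ^+ 3 * f3 i) ^+ 2 =
     c0 + c2 * t ^+ 2 + c4 * t ^+ 4 + c6 * t ^+ 6) ->
  [/\ \sum_(i <- s) f0 i ^+ 2 = c0,
      \sum_(i <- s) f1 i ^+ 2 + 2 * \sum_(i <- s) f0 i * f2 i = c2,
      \sum_(i <- s) f2 i ^+ 2 + 2 * \sum_(i <- s) f1 i * f3 i = c4
    & \sum_(i <- s) f3 i ^+ 2 = c6].
Proof.
move=> fE.
pose S (f g : I -> R) := \sum_(i <- s) f i * g i.
have SE t : S f0 f0 + t * (2 * S f0 f1) + t ^+ 2 * (S f1 f1 + 2 * S f0 f2) +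
    t ^+ 3 * (2 * S f0 f3 + 2 * S f1 f2) + t ^+ 4 * (S f2 f2 + 2 * S f1 f3) +
    t ^+ 5 * (2 * S f2 f3) + t ^+ 6 * S f3 f3 =
    c0 + c2 * t ^+ 2 + c4 * t ^+ 4 + c6 * t ^+ 6.
  rewrite -fE /S !mulr_sumr -!big_split /= !mulr_sumr -!big_split /=.
  by apply: eq_bigr => i _; ring.
have sqE f : \sum_(i <- s) f i ^+ 2 = S f f by apply: eq_bigr.
rewrite !sqE -/(S f0 f2) -/(S f1 f3).
have := (SE 0, SE 1, SE (-1), SE 2, SE (-2), SE 3, SE (-3)).
by move=> [[[[[[h0 h1] h2] h3] h4] h5] h6]; split; lra.
Qed.

Lemma theta_rank_Kcone (R : realType) n (G : graph n) r :
  theta_rank R G = Some r -> Kcone r (graphmx R G).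
Proof.
rewrite /theta_rank; case: pselect => // exr [<-].
by case: ex_minnP => d /asboolP.
Qed.

(** * The numerical bound *)

(** This is Cauchy-Schwarz for T1 and T3, multiplied by 4 k^2, with sum T1^2 = b k, sum T3^2 = b + k
    - 1 and 2 k sum T1 T3 = b (k (b + k - 3) - b). *)
Lemma theta_rank1_quadratic (R : realType) (n m : nat) (H : graph n) (k b : R) :
  (alpha H)%:R = k -> m%:R = b ->
  (2 <= alpha H)%N -> connected (critical_graph H) ->
  theta_rank R (dunion H (edgeless m)) = Some 1%N ->
  (b * (k * (b + k - 3) - b)) ^+ 2 <= 4 * k ^+ 3 * b * (b + k - 1).
Proof.
move=> kE bE k2 conn hrank.
have [I [s [T [cT TE]]]] := Kcone1_cubic (theta_rank_Kcone hrank).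
have k2' : 2 <= k by rewrite -kE (ler_nat R 2).
have b0 : 0 <= b by rewrite -bE ler0n.
have [u _] : exists u : 'I_n, true.
  have [S _ cS] := alpha_attained H.
  have /card_gt0P[u _] : (0 < #|S|)%N by rewrite cS (leq_trans _ k2).
  by exists u.
have T0 i x : i \in s -> biquadratic (graphmx R (dunion H (edgeless m))) x = 0 -> T i x = 0.
  by rewrite -TE => si /sum_sq_eq0; apply.
pose w := isolated_vec R n m; pose e : 'rV[R]_(n + m) := delta_mx 0 (lshift m u).
pose f1 i := polar1 (T i) w e; pose f2 i := polar2 (T i) w e.
have f0E i : i \in s -> T i w = - k * f2 i.
  by move=> si; rewrite -kE; apply: cubic_critical_connected => // x; apply: T0.
(* The constants are the coefficients of (b + t^2) ((k + b) (b + t^4) - (b + t^2)^2), the value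
   given by [biquadratic_line]. *)
have [t|S00 S11 S22 S33] := @sum_sq_cubic_coefs R I s (fun i => T i w) f1 f2 (fun i => T i e)
    (b ^+ 2 * k) (b * k - 2 * b ^+ 2) (b * (b + k - 3)) (b + k - 1).
  under eq_bigr do rewrite -cubic_expand //.
  by rewrite TE biquadratic_line natrD kE bE; ring.
(* The relation T(w) = - k T2 expresses the sums containing T(w) through sum T2^2, which therefore
   equals b^2 / k. *)
have S00' : k ^+ 2 * (\sum_(i <- s) f2 i ^+ 2) = b ^+ 2 * k.
  rewrite -S00 mulr_sumr; apply: eq_big_seq => i /f0E ->; ring.
have S02 : \sum_(i <- s) T i w * f2 i = - k * \sum_(i <- s) f2 i ^+ 2.
  by rewrite mulr_sumr; apply: eq_big_seq => i /f0E ->; ring.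
have S33' : 0 < \sum_(i <- s) T i e ^+ 2 by rewrite S33; lra.
have := sum_mul_sqr_le f1 S33'; rewrite S33.
move: S00' S02 S11 S22.
set A := \sum_(i <- s) f2 i ^+ 2; set C := \sum_(i <- s) f1 i * T i e.
set D := \sum_(i <- s) f1 i ^+ 2; set E := \sum_(i <- s) _ * _.
move=> kA EE DE CE.
have k0 : k != 0 by lra.
have {}kA : k * A = b ^+ 2 by apply: (mulfI k0); rewrite -[RHS]mulrC -kA; ring.
have -> : D = b * k by move: DE; rewrite EE mulNr kA; lra.
have -> : b * (k * (b + k - 3) - b) = 2 * k * C.
  transitivity (k * (b * (b + k - 3)) - b ^+ 2); first by ring.
  by rewrite -CE -kA; ring.
move=> CS; rewrite exprMn.
apply: le_trans (ler_wpM2l (sqr_ge0 _) CS) _.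
by rewrite le_eqVlt; apply/orP; left; apply/eqP; ring.
Qed.

(** If the bound fails, then b (k - 1) > 4 k, hence k (b + k - 3) - b > k (k + 1). The hypothesis
    then gives b (k + 1)^2 <= 4 k (b + k - 1), that is, b (k - 1)^2 <= 4 k (k - 1), a
    contradiction. *)
Lemma quadratic_ineq_bound (R : realFieldType) (k b : R) : 2 <= k -> 0 < b ->
  (b * (k * (b + k - 3) - b)) ^+ 2 <= 4 * k ^+ 3 * b * (b + k - 1) ->
  (b + k) * (k - 1) <= k * (k + 3).
Proof.
move=> k2 b0 ineq.
have ineq' : b * (k * (b + k - 3) - b) ^+ 2 <= 4 * k ^+ 3 * (b + k - 1).
  rewrite -(ler_pM2l b0); apply: le_trans (le_trans ineq _).
    by rewrite le_eqVlt; apply/orP; left; apply/eqP; ring.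
  by rewrite le_eqVlt; apply/orP; left; apply/eqP; ring.
rewrite leNgt; apply/negP => lt.
have bk : 4 * k < b * (k - 1) by lra.
have sq : (k * (k + 1)) ^+ 2 <= (k * (b + k - 3) - b) ^+ 2.
  have k0 : 0 <= k * (k + 1) by rewrite mulr_ge0 //; lra.
  have kb : k * (k + 1) <= k * (b + k - 3) - b by lra.
  by rewrite ler_pXn2r ?nnegrE // (le_trans k0 kb).
have := le_trans (ler_wpM2l (ltW b0) sq) ineq'.
have -> : b * (k * (k + 1)) ^+ 2 = k ^+ 2 * (b * (k + 1) ^+ 2) by ring.
have -> : 4 * k ^+ 3 * (b + k - 1) = k ^+ 2 * (4 * k * (b + k - 1)) by ring.
rewrite ler_pM2l; last by rewrite exprn_gt0; lra.
have : 4 * k * (k - 1) < b * (k - 1) * (k - 1) by rewrite ltr_pM2r; lra.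
nra.
Qed.

Theorem theorem6p6 (R : realType) (n a k : nat) (H : graph n)
    (hk : (2 <= k)%N) (hka : (k < a)%N) (hH : alpha H = k)
    (hconn : connected (critical_graph H))
    (hrank : theta_rank R (dunion H (edgeless (a - k)%N)) = Some 1%N) :
  (a%:R : R) <= (k%:R * (k%:R + 3)) / (k%:R - 1) /\
  (k%:R * (k%:R + 3)) / (k%:R - 1) = k%:R + 4 + 4 / (k%:R - 1) :> R.
Proof.
have k2 : 2 <= k%:R :> R by rewrite (ler_nat R 2).
split; last by move: (k%:R : R) k2 => x x2; clear -x2; field; lra.
have := theta_rank1_quadratic erefl erefl _ hconn hrank; rewrite hH => /(_ hk).
have -> : a%:R = (a - k)%N%:R + k%:R :> R by rewrite -natrD subnK // ltnW.
rewrite ler_pdivlMr; last by lra.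
by apply: quadratic_ineq_bound => //; rewrite ltr0n subn_gt0.
Qed.
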